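(* Let $(\mathcal{C},\mathbb{E},\mathfrak{s})$ be a Frobenius extriangulated category, let $\omega$ be the full subcategory consisting of the projective-injective objects, let $\underline{\mathcal{C}}=\mathcal{C}/\omega$ be the stable category, and let $n$ be a positive integer. Let $\mathcal{I},\mathcal{J}$ be two ideals of $\mathcal{C}$, where $\omega\subseteq\mathrm{Ob}(\mathcal{I})$. Then $(\mathcal{I},\mathcal{J})$ is an ideal $n$-cotorsion pair in $\mathcal{C}$ if and only if $(\mathcal{I}/\omega,\mathcal{J}/\omega)$ is an ideal $n$-cotorsion pair in $\underline{\mathcal{C}}$.
   Context: **Extriangulated categories.** $(\mathcal{C},\mathbb{E},\mathfrak{s})$ is an extriangulated category in the sense of Nakaoka–Palu: $\mathcal{C}$ is an additive category, $\mathbb{E}\colon\mathcal{C}^{\mathrm{op}}\times\mathcal{C}\to\mathrm{Ab}$ is an additive bifunctor, and $\mathfrak{s}$ is an additive realization assigning to each $\delta\in\mathbb{E}(C,A)$ an equivalence class of sequences $A\to B\to C$, subject to axioms (ET3), (ET3)$^{\mathrm{op}}$, (ET4), (ET4)$^{\mathrm{op}}$. If $A\xrightarrow{x}B\xrightarrow{y}C$ realizes $\delta$, one writes $A\xrightarrow{x}B\xrightarrow{y}C\overset{\delta}{\dashrightarrow}$ (an $\mathbb{E}$-triangle); $x$ is an inflation and $y$ a deflation. For $a\colon A\to A'$, $c\colon C'\to C$ put $a_*\delta=\mathbb{E}(C,a)(\delta)$, $c^*\delta=\mathbb{E}(c,A)(\delta)$. For $i\colon A\to B$, $j\colon X\to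 Y$, $\mathbb{E}(i,j)\colon\mathbb{E}(B,X)\to\mathbb{E}(A,Y)$ is $\delta\mapsto j_*i^*\delta$. An object $P$ is projective if $\mathbb{E}(P,-)=0$, and $I$ is injective if $\mathbb{E}(-,I)=0$. $\mathcal{C}$ is Frobenius if it has enough projectives (every $C$ admits a deflation $P\to C$ with $P$ projective), enough injectives (dually), and projective and injective objects coincide. **Higher extensions.** For each object $A$ choose $\mathbb{E}$-triangles $\Omega A\to P(A)\to A\dashrightarrow$ and $A\to I(A)\to\Sigma A\dashrightarrow$ with $P(A)$ projective and $I(A)$ injective; for a morphism $i\colon A\to B$ choose $\Omega i\colon\Omega A\to\Omega B$ and $\Sigma i\colon\Sigma A\to\Sigma B$ fitting into morphisms of these $\mathbb{E}$-triangles with $i$. For $k\ge1$, $\mathbb{E}^k(A,B)=\mathbb{E}(A,\Sigma^{k-1}B)\cong\mathbb{E}(\Omega^{k-1}A,B)$ and $\mathbb{E}^k(i,j)=\mathbb{E}(i,\Sigma^{k-1}j)\cong\mathbb{E}(\Omega^{k-1}i,j)$; these are well defined up to isomorphism. **Stable category.** $\underline{\mathcal{C}}=\mathcal{C}/\omega$ has the objects of $\mathcal{C}$ and morphism groups $\mathrm{Hom}_{\mathcal{C}}(X,Y)$ modulo the subgroup of morphisms factoring through an object of $\omega$; the class of $f$ is $\underline f$. It is a triangulated category with shift $\Sigma$ (Nakaoka–Palu, Zhou–Zhu), regarded as an extriangulated category with $\mathbb{E}(-,-)=\underline{\mathcal{C}}(-,\Sigma-)$, so that there $\mathbb{E}^k(f,g)=\underline{\mathcal{C}}(f,\Sigma^kg)$,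 where for $f\colon A\to B$, $g\colon X\to Y$, $\underline{\mathcal{C}}(f,g)$ is the map $\underline{\mathcal{C}}(B,X)\to\underline{\mathcal{C}}(A,Y)$, $\varphi\mapsto g\varphi f$. **Ideals.** An ideal $\mathcal{I}$ is a collection of subgroups $\mathcal{I}(X,Y)\subseteq\mathrm{Hom}(X,Y)$ closed under composition with arbitrary morphisms on both sides; $\mathrm{Ob}(\mathcal{I})=\{X\mid1_X\in\mathcal{I}\}$. $\mathcal{I}/\omega=\{\underline f\mid f\in\mathcal{I}\}$ is the induced ideal of $\underline{\mathcal{C}}$, and similarly $\mathcal{J}/\omega$. For $k\ge1$, ${}^{\perp_k}\mathcal{S}=\{f\mid\mathbb{E}^k(f,s)=0\ \forall s\in\mathcal{S}\}$ and $\mathcal{S}^{\perp_k}=\{g\mid\mathbb{E}^k(s,g)=0\ \forall s\in\mathcal{S}\}$. $\mathcal{I}$ is precovering if every object $M$ has an $\mathcal{I}$-precover, i.e. a morphism $f\colon X\to M$ in $\mathcal{I}$ through which every morphism $X'\to M$ in $\mathcal{I}$ factors; preenveloping is defined dually. **Ideal $n$-cotorsion pair.** A pair of ideals $(\mathcal{I},\mathcal{J})$ of an extriangulated category such that (1) $\mathcal{I}=\bigcap_{k=1}^n{}^{\perp_k}\mathcal{J}$; (2) $\mathcal{J}=\bigcap_{k=1}^n\mathcal{I}^{\perp_k}$; (3) $\mathcal{I}$ is precovering and $\mathcal{J}$ is preenveloping.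
   Formalization: The condition ω ⊆ Ob(J) is added to the right-hand side of the equivalence; without it the ''if'' direction fails (e.g. C = finite-dimensional vector spaces with E = 0, I = all morphisms, J = 0), and the ''only if'' direction proves it. *)

(* Defs.v *)
From HB Require Import structures.
From mathcomp Require Import all_boot all_order all_algebra.
From mathcomp Require Import generic_quotient ring_quotient.
From mathcomp Require Import boolp.

Set Implicit Arguments.
Unset Strict Implicit.
Unset Printing Implicit Defensive.

Import GRing.Theory.
Local Open Scope ring_scope.
Local Open Scope quotient_scope.

Record preaddCat := PreaddCat {
  obj :> Type;
  Mor : obj -> obj -> zmodType;
  idm : forall A, Mor A A;
  mcomp : forall A B C, Mor B C -> Mor A B -> Mor A C;
  mcomp_idl : forall A B (f : Mor A B), mcomp (idm B) f = f;
  mcomp_idr : forall A B (f : Mor A B), mcomp f (idm A) = f;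
  mcompA : forall A B C D (h : Mor C D) (g : Mor B C) (f : Mor A B),
    mcomp h (mcomp g f) = mcomp (mcomp h g) f;
  mcompDl : forall A B C (g g' : Mor B C) (f : Mor A B),
    mcomp (g + g') f = mcomp g f + mcomp g' f;
  mcompDr : forall A B C (g : Mor B C) (f f' : Mor A B),
    mcomp g (f + f') = mcomp g f + mcomp g f' }.

Arguments Mor {p} A B.
Arguments idm {p} A.
Arguments mcomp {p A B C} g f.

Declare Scope cat_scope.
Delimit Scope cat_scope with cat.
Notation "g \c f" := (mcomp g f)
  (at level 40, left associativity, format "g  \c  f") : cat_scope.
Open Scope cat_scope.

Definition is_zero_obj (C : preaddCat) (Z : C) : Prop := idm Z = 0.

Definition is_biprod (C : preaddCat) (A B S : C) (i1 : Mor A S) (i2 : Mor B S)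
    (p1 : Mor S A) (p2 : Mor S B) : Prop :=
  [/\ p1 \c i1 = idm A, p2 \c i2 = idm B, p1 \c i2 = 0, p2 \c i1 = 0
    & i1 \c p1 + i2 \c p2 = idm S].

Record addCat := AddCat {
  preadd_of :> preaddCat;
  has_zero : exists Z : preadd_of, is_zero_obj Z;
  has_biprod : forall A B : preadd_of, exists S (i1 : Mor A S) (i2 : Mor B S)
    (p1 : Mor S A) (p2 : Mor S B), is_biprod i1 i2 p1 p2 }.

Definition is_iso (C : preaddCat) (A B : C) (f : Mor A B) : Prop :=
  exists g : Mor B A, g \c f = idm A /\ f \c g = idm B.

Section PreaddTheory.
Variable C : preaddCat.
Implicit Types A B D : C.

Lemma mcomp0l A B D (f : Mor A B) : (0 : Mor B D) \c f = 0.
Proof. by apply: (addrI (0 \c f)); rewrite -mcompDl !addr0. Qed.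
Lemma mcomp0r A B D (g : Mor B D) : g \c (0 : Mor A B) = 0.
Proof. by apply: (addrI (g \c 0)); rewrite -mcompDr !addr0. Qed.
Lemma mcompNl A B D (g : Mor B D) (f : Mor A B) : (- g) \c f = - (g \c f).
Proof. by apply: (addrI (g \c f)); rewrite -mcompDl !subrr mcomp0l. Qed.
Lemma mcompNr A B D (g : Mor B D) (f : Mor A B) : g \c (- f) = - (g \c f).
Proof. by apply: (addrI (g \c f)); rewrite -mcompDr !subrr mcomp0r. Qed.
Lemma mcompBl A B D (g g' : Mor B D) (f : Mor A B) :
  (g - g') \c f = g \c f - g' \c f.
Proof. by rewrite mcompDl mcompNl. Qed.
Lemma mcompBr A B D (g : Mor B D) (f f' : Mor A B) :
  g \c (f - f') = g \c f - g \c f'.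
Proof. by rewrite mcompDr mcompNr. Qed.

End PreaddTheory.

(* [push a d] is $a_* d$ and [pull c d] is $c^* d$. *)
Record biext (C : addCat) := Biext {
  Ext :> C -> C -> zmodType;
  push : forall X A A', Mor A A' -> Ext X A -> Ext X A';
  pull : forall X X' A, Mor X' X -> Ext X A -> Ext X' A;
  push_id : forall X A (d : Ext X A), push (idm A) d = d;
  pull_id : forall X A (d : Ext X A), pull (idm X) d = d;
  push_comp : forall X A B D (g : Mor B D) (f : Mor A B) (d : Ext X A),
    push (g \c f) d = push g (push f d);
  pull_comp : forall X Y Z A (g : Mor Y X) (f : Mor Z Y) (d : Ext X A),
    pull (g \c f) d = pull f (pull g d);
  push_pull : forall X X' A A' (a : Mor A A') (c : Mor X' X) (d : Ext X A),
    push a (pull c d) = pull c (push a d);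
  pushDr : forall X A A' (a : Mor A A') (d d' : Ext X A),
    push a (d + d') = push a d + push a d';
  pullDr : forall X X' A (c : Mor X' X) (d d' : Ext X A),
    pull c (d + d') = pull c d + pull c d';
  pushDl : forall X A A' (a a' : Mor A A') (d : Ext X A),
    push (a + a') d = push a d + push a' d;
  pullDl : forall X X' A (c c' : Mor X' X) (d : Ext X A),
    pull (c + c') d = pull c d + pull c' d }.

Arguments push {C b X A A'} a d.
Arguments pull {C b X X' A} c d.

Section BiextTheory.
Variables (C : addCat) (E : biext C).
Implicit Types A B X Y : C.

Lemma push0r X A B (a : Mor A B) : push a (0 : E X A) = 0.
Proof. by apply: (addrI (push a 0)); rewrite -pushDr !addr0. Qed.
Lemma pull0r X Y A (c : Mor Y X) : pull c (0 : E X A) = 0.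
Proof. by apply: (addrI (pull c 0)); rewrite -pullDr !addr0. Qed.
Lemma push0l X A B (d : E X A) : push (0 : Mor A B) d = 0.
Proof. by apply: (addrI (push 0 d)); rewrite -pushDl !addr0. Qed.
Lemma pull0l X Y A (d : E X A) : pull (0 : Mor Y X) d = 0.
Proof. by apply: (addrI (pull 0 d)); rewrite -pullDl !addr0. Qed.
Lemma pullBl X Y A (c c' : Mor Y X) (d : E X A) :
  pull (c - c') d = pull c d - pull c' d.
Proof. by apply: (addIr (pull c' d)); rewrite -pullDl !subrK. Qed.

End BiextTheory.

(* Equivalence of two sequences A -> B -> D and A -> B' -> D with the same
   end terms. *)
Definition seq_equiv (C : preaddCat) (A D B B' : C) (x : Mor A B) (y : Mor B D)
    (x' : Mor A B') (y' : Mor B' D) : Prop :=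
  exists b : Mor B B', [/\ is_iso b, b \c x = x' & y' \c b = y].

(* [real d x y] says that the sequence given by x, y belongs to the
   equivalence class s(d). *)
Record extriCat := ExtriCat {
  base :> addCat;
  EE : biext base;
  real : forall (X A : base) (d : EE X A) (B : base),
    Mor A B -> Mor B X -> Prop;
  real_ex : forall (X A : base) (d : EE X A), exists B (x : Mor A B) (y : Mor B X),
    real d x y;
  real_equiv : forall (X A : base) (d : EE X A) (B B' : base)
      (x : Mor A B) (y : Mor B X) (x' : Mor A B') (y' : Mor B' X),
    real d x y -> (real d x' y' <-> seq_equiv x y x' y');
  real_mor : forall (X A X' A' : base) (d : EE X A) (d' : EE X' A') (B B' : base)
      (x : Mor A B) (y : Mor B X) (x' : Mor A' B') (y' : Mor B' X')
      (a : Mor A A') (c : Mor X X'),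
    real d x y -> real d' x' y' -> push a d = pull c d' ->
    exists b : Mor B B', b \c x = x' \c a /\ y' \c b = c \c y;
  real_zero : forall (A X S : base) (i1 : Mor A S) (i2 : Mor X S)
      (p1 : Mor S A) (p2 : Mor S X),
    is_biprod i1 i2 p1 p2 -> real (0 : EE X A) i1 p2;
  real_sum : forall (A A' SA : base) (iA : Mor A SA) (iA' : Mor A' SA)
      (pA : Mor SA A) (pA' : Mor SA A')
      (B B' SB : base) (iB : Mor B SB) (iB' : Mor B' SB)
      (pB : Mor SB B) (pB' : Mor SB B')
      (X X' SX : base) (iX : Mor X SX) (iX' : Mor X' SX)
      (pX : Mor SX X) (pX' : Mor SX X')
      (d : EE X A) (d' : EE X' A')
      (x : Mor A B) (y : Mor B X) (x' : Mor A' B') (y' : Mor B' X'),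
    is_biprod iA iA' pA pA' -> is_biprod iB iB' pB pB' ->
    is_biprod iX iX' pX pX' ->
    real d x y -> real d' x' y' ->
    real (push iA (pull pX d) + push iA' (pull pX' d'))
         (iB \c x \c pA + iB' \c x' \c pA')
         (iX \c y \c pB + iX' \c y' \c pB');
  ET3 : forall (X A X' A' : base) (d : EE X A) (d' : EE X' A') (B B' : base)
      (x : Mor A B) (y : Mor B X) (x' : Mor A' B') (y' : Mor B' X')
      (a : Mor A A') (b : Mor B B'),
    real d x y -> real d' x' y' -> b \c x = x' \c a ->
    exists c : Mor X X', c \c y = y' \c b /\ push a d = pull c d';
  ET3op : forall (X A X' A' : base) (d : EE X A) (d' : EE X' A') (B B' : base)
      (x : Mor A B) (y : Mor B X) (x' : Mor A' B') (y' : Mor B' X')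
      (b : Mor B B') (c : Mor X X'),
    real d x y -> real d' x' y' -> c \c y = y' \c b ->
    exists a : Mor A A', b \c x = x' \c a /\ push a d = pull c d';
  ET4 : forall (A B D G F : base) (f : Mor A B) (f' : Mor B D)
      (g : Mor B G) (g' : Mor G F) (d : EE D A) (d' : EE F B),
    real d f f' -> real d' g g' ->
    exists (W : base) (h' : Mor G W) (u : Mor D W) (v : Mor W F) (d'' : EE W A),
      [/\ real d'' (g \c f) h', h' \c g = u \c f' & v \c h' = g'] /\
      [/\ real (push f' d') u v, pull u d'' = d & push f d'' = pull v d'];
  ET4op : forall (A B D G F : base) (f' : Mor D A) (f : Mor A B)
      (g' : Mor F B) (g : Mor B G) (d : EE B D) (d' : EE G F),
    real d f' f -> real d' g' g ->
    exists (W : base) (h' : Mor W A) (u : Mor D W) (v : Mor W F) (d'' : EE G W),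
      [/\ real d'' h' (g \c f), h' \c u = f' & f \c h' = g' \c v] /\
      [/\ real (pull g' d) u v, push v d'' = d' & push u d = pull g d''] }.

Arguments EE {e}.
Arguments real {e X A} d {B} x y.

Section Frobenius.
Variable C : extriCat.

Definition is_projective (P : C) : Prop := forall (A : C) (d : EE P A), d = 0.
Definition is_injective (I : C) : Prop := forall (X : C) (d : EE X I), d = 0.

Definition deflation (B X : C) (y : Mor B X) : Prop :=
  exists (A : C) (d : EE X A) (x : Mor A B), real d x y.
Definition inflation (A B : C) (x : Mor A B) : Prop :=
  exists (X : C) (d : EE X A) (y : Mor B X), real d x y.

Definition enough_projectives : Prop :=
  forall X : C, exists (P : C) (y : Mor P X), is_projective P /\ deflation y.
Definition enough_injectives : Prop :=
  forall A : C, exists (I : C) (x : Mor A I), is_injective I /\ inflation x.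

Definition frobenius : Prop :=
  [/\ enough_projectives, enough_injectives
    & forall X : C, is_projective X <-> is_injective X].

Definition omega (X : C) : Prop := is_projective X /\ is_injective X.

(* A choice, for every A, of an E-triangle A -> I(A) -> Sigma A with I(A)
   injective and, for every f, of a morphism of these E-triangles extending f.
   It is not assumed to be functorial. *)
Record cosyzygy := Cosyzygy {
  csI : C -> C;
  csS : C -> C;
  cs_in : forall A, Mor A (csI A);
  cs_out : forall A, Mor (csI A) (csS A);
  cs_ext : forall A, EE (csS A) A;
  cs_real : forall A, real (cs_ext A) (cs_in A) (cs_out A);
  cs_inj : forall A, is_injective (csI A);
  csI_mor : forall A B, Mor A B -> Mor (csI A) (csI B);
  csS_mor : forall A B, Mor A B -> Mor (csS A) (csS B);
  cs_in_mor : forall A B (f : Mor A B),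
    csI_mor f \c cs_in A = cs_in B \c f;
  cs_out_mor : forall A B (f : Mor A B),
    csS_mor f \c cs_out A = cs_out B \c csI_mor f;
  cs_ext_mor : forall A B (f : Mor A B),
    push f (cs_ext A) = pull (csS_mor f) (cs_ext B) }.

End Frobenius.

Arguments is_projective {C} P.
Arguments is_injective {C} I.
Arguments omega {C} X.

(* The data out of which E^k is formed: the bifunctor E together with the
   assignments A |-> Sigma A, f |-> Sigma f. *)
Record extData (C : addCat) := ExtData {
  ed_ext :> biext C;
  ed_obj : C -> C;
  ed_mor : forall A B, Mor A B -> Mor (ed_obj A) (ed_obj B) }.

Arguments ed_mor {C} e {A B} f.

Section HigherExt.
Variables (C : addCat) (D : extData C).

Fixpoint shift_obj (m : nat) (A : C) : C :=
  if m is m'.+1 then ed_obj D (shift_obj m' A) else A.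

Fixpoint shift_mor (m : nat) (A B : C) (f : Mor A B) :
    Mor (shift_obj m A) (shift_obj m B) :=
  if m is m'.+1 then ed_mor D (shift_mor m' f) else f.

(* E^k(A, B), meaningful for k >= 1. *)
Definition Extk (k : nat) (A B : C) : zmodType := D A (shift_obj k.-1 B).

Definition Extk_map (k : nat) (A B X Y : C) (i : Mor A B) (j : Mor X Y) :
    Extk k B X -> Extk k A Y :=
  fun d => push (shift_mor k.-1 j) (pull i d).

End HigherExt.

Arguments Extk_map {C} D k {A B X Y} i j d.

Definition extriData (C : extriCat) (S : cosyzygy C) : extData C :=
  ExtData (@EE C) (@csS_mor C S).

Definition homClass (C : preaddCat) := forall A B : C, Mor A B -> Prop.

Record ideal (C : addCat) := Ideal {
  ideal_in :> homClass C;
  ideal0 : forall A B, ideal_in (0 : Mor A B);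
  idealB : forall A B (f g : Mor A B),
    ideal_in f -> ideal_in g -> ideal_in (f - g);
  ideal_compl : forall A B D (g : Mor B D) (f : Mor A B),
    ideal_in f -> ideal_in (g \c f);
  ideal_compr : forall A B D (g : Mor B D) (f : Mor A B),
    ideal_in g -> ideal_in (g \c f) }.

Arguments ideal_in {C} i {A B} _.

Definition ideal_ob (C : addCat) (I : ideal C) (A : C) : Prop := ideal_in I (idm A).

Definition precover (C : addCat) (I : homClass C) (X M : C) (f : Mor X M) : Prop :=
  I _ _ f /\ forall (X' : C) (g : Mor X' M), I _ _ g ->
    exists h : Mor X' X, f \c h = g.
Definition preenvelope (C : addCat) (I : homClass C) (M X : C) (f : Mor M X) : Prop :=
  I _ _ f /\ forall (X' : C) (g : Mor M X'), I _ _ g ->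
    exists h : Mor X X', h \c f = g.

Definition precovering (C : addCat) (I : homClass C) : Prop :=
  forall M : C, exists (X : C) (f : Mor X M), precover I f.
Definition preenveloping (C : addCat) (I : homClass C) : Prop :=
  forall M : C, exists (X : C) (f : Mor M X), preenvelope I f.

Section Cotorsion.
Variables (C : addCat) (D : extData C).

Definition lperp (k : nat) (S : homClass C) : homClass C :=
  fun A B f => forall (X Y : C) (s : Mor X Y), S X Y s ->
    forall d, Extk_map D k f s d = 0.
Definition rperp (k : nat) (S : homClass C) : homClass C :=
  fun X Y g => forall (A B : C) (s : Mor A B), S A B s ->
    forall d, Extk_map D k s g d = 0.

Definition ideal_cotorsion_pair (n : nat) (I J : ideal C) : Prop :=
  [/\ forall A B (f : Mor A B),
        ideal_in I f <-> (forall k, (1 <= k <= n)%N -> lperp k J f),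
      forall A B (g : Mor A B),
        ideal_in J g <-> (forall k, (1 <= k <= n)%N -> rperp k I g),
      precovering I
    & preenveloping J].

End Cotorsion.

Section Stable.
Variable C : extriCat.
Implicit Types A B D X Y : C.

Lemma projective_biprod A B S (i1 : Mor A S) (i2 : Mor B S) p1 p2 :
  is_biprod i1 i2 p1 p2 -> is_projective A -> is_projective B -> is_projective S.
Proof.
case=> _ _ _ _ e pA pB X d; rewrite -[d]pull_id -e pullDl !pull_comp.
by rewrite (pA _ (pull i1 d)) (pB _ (pull i2 d)) !pull0r addr0.
Qed.

Lemma injective_biprod A B S (i1 : Mor A S) (i2 : Mor B S) p1 p2 :
  is_biprod i1 i2 p1 p2 -> is_injective A -> is_injective B -> is_injective S.
Proof.
case=> _ _ _ _ e pA pB X d; rewrite -[d]push_id -e pushDl !push_comp.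
by rewrite (pA _ (push p1 d)) (pB _ (push p2 d)) !push0r addr0.
Qed.

Lemma omega_zero (Z : C) : is_zero_obj Z -> omega Z.
Proof.
by move=> e; split=> X d;
  [rewrite -[d]pull_id e pull0l | rewrite -[d]push_id e push0l].
Qed.

Definition via_omega A B (f : Mor A B) : Prop :=
  exists (W : C) (u : Mor A W) (v : Mor W B), omega W /\ f = v \c u.

Definition null_hom A B : pred (Mor A B) := fun f => `[< via_omega f >].

Fact null_hom_zmod_closed A B : zmod_closed (@null_hom A B).
Proof.
split=> [|f g].
  apply/asboolP; have [Z z] := has_zero C.
  by exists Z, 0, 0; split; [exact: omega_zero | rewrite mcomp0l].
move=> /asboolP[W [u [v [[pW iW] ->]]]] /asboolP[W' [u' [v' [[pW' iW'] ->]]]].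
apply/asboolP; have [S [i1 [i2 [p1 [p2 b]]]]] := has_biprod W W'.
exists S, (i1 \c u + i2 \c u'), (v \c p1 - v' \c p2); split.
  by split; [exact: projective_biprod b _ _ | exact: injective_biprod b _ _].
case: b => e1 e2 e3 e4 _.
rewrite mcompBl !mcompDr -!mcompA !(mcompA p1) !(mcompA p2) e1 e2 e3 e4.
by rewrite !mcomp_idl !mcomp0l !mcomp0r addr0 add0r.
Qed.

HB.instance Definition _ A B :=
  GRing.isZmodClosed.Build (Mor A B) (@null_hom A B) (@null_hom_zmod_closed A B).

Definition null_sub A B : zmodClosed (Mor A B) :=
  GRing.ZmodClosed.clone (Mor A B) (@null_hom A B) _.

Definition sHom A B : zmodType := Quotient.quot (null_sub A B).

Definition cls A B (f : Mor A B) : sHom A B := \pi_(Quotient.quot (null_sub A B)) f.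

Lemma cls_eq A B (f g : Mor A B) : cls f = cls g <-> via_omega (f - g).
Proof.
rewrite /cls; split=> [e|h].
  by apply/asboolP; rewrite -[asbool _]/(f - g \in null_sub A B)
     Quotient.idealrBE; apply/eqP.
by apply/eqP; rewrite -Quotient.idealrBE; apply/asboolP.
Qed.

Lemma cls_surj A B (p : sHom A B) : exists f, p = cls f.
Proof. by exists (repr p); rewrite /cls reprK. Qed.

Lemma clsD A B (f g : Mor A B) : cls (f + g) = cls f + cls g.
Proof. exact: (raddfD (\pi_(Quotient.quot (null_sub A B)))). Qed.
Lemma cls0 A B : cls (0 : Mor A B) = 0.
Proof. exact: (raddf0 (\pi_(Quotient.quot (null_sub A B)))). Qed.
Lemma clsB A B (f g : Mor A B) : cls (f - g) = cls f - cls g.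
Proof. exact: (raddfB (\pi_(Quotient.quot (null_sub A B)))). Qed.

Lemma via_omega_comp A B X Y (h : Mor X Y) (g : Mor B X) (f : Mor A B) :
  via_omega g -> via_omega (h \c g \c f).
Proof.
by move=> [W [u [v [w ->]]]]; exists W, (u \c f), (h \c v); rewrite !mcompA.
Qed.

Definition scomp A B X (g : sHom B X) (f : sHom A B) : sHom A X :=
  cls (repr g \c repr f).

Lemma scompE A B X (g : Mor B X) (f : Mor A B) :
  scomp (cls g) (cls f) = cls (g \c f).
Proof.
have repr_cls X1 X2 (k : Mor X1 X2) : via_omega (repr (cls k) - k).
  by apply/cls_eq; rewrite /cls reprK.
apply: etrans (_ : cls (repr (cls g) \c f) = _); apply/cls_eq.
  by rewrite -mcompBr -[_ \c _]mcomp_idr; apply: via_omega_comp.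
by rewrite -mcompBl -[_ - g]mcomp_idl; apply: via_omega_comp.
Qed.

Lemma scomp_idl A B (f : sHom A B) : scomp (cls (idm B)) f = f.
Proof. by have [g ->] := cls_surj f; rewrite scompE mcomp_idl. Qed.
Lemma scomp_idr A B (f : sHom A B) : scomp f (cls (idm A)) = f.
Proof. by have [g ->] := cls_surj f; rewrite scompE mcomp_idr. Qed.
Lemma scompA A B X Y (h : sHom X Y) (g : sHom B X) (f : sHom A B) :
  scomp h (scomp g f) = scomp (scomp h g) f.
Proof.
have [f' ->] := cls_surj f; have [g' ->] := cls_surj g.
by have [h' ->] := cls_surj h; rewrite !scompE mcompA.
Qed.
Lemma scompDl A B X (g g' : sHom B X) (f : sHom A B) :
  scomp (g + g') f = scomp g f + scomp g' f.
Proof.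
have [f1 ->] := cls_surj f; have [g1 ->] := cls_surj g.
by have [g2 ->] := cls_surj g'; rewrite -clsD !scompE mcompDl clsD.
Qed.
Lemma scompDr A B X (g : sHom B X) (f f' : sHom A B) :
  scomp g (f + f') = scomp g f + scomp g f'.
Proof.
have [f1 ->] := cls_surj f; have [g1 ->] := cls_surj g.
by have [f2 ->] := cls_surj f'; rewrite -clsD !scompE mcompDr clsD.
Qed.

Definition stable_preadd : preaddCat :=
  @PreaddCat C sHom (fun A => cls (idm A)) scomp scomp_idl scomp_idr scompA
    scompDl scompDr.

Fact stable_has_zero : exists Z : stable_preadd, is_zero_obj Z.
Proof.
have [Z z] := has_zero C; exists Z.
by rewrite /is_zero_obj /= (z : idm Z = 0) cls0.
Qed.

Fact stable_has_biprod (A B : stable_preadd) :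
  exists S (i1 : Mor A S) (i2 : Mor B S) (p1 : Mor S A) (p2 : Mor S B),
    is_biprod i1 i2 p1 p2.
Proof.
have [S [i1 [i2 [p1 [p2 [e1 e2 e3 e4 e5]]]]]] := @has_biprod C A B.
exists S, (cls i1), (cls i2), (cls p1), (cls p2).
by split; rewrite /= !scompE ?e1 ?e2 ?e3 ?e4 ?cls0 // -clsD e5.
Qed.

Definition stable : addCat := AddCat stable_has_zero stable_has_biprod.

Definition contains_omega (I : ideal C) : Prop :=
  forall W : C, omega W -> ideal_ob I W.

(* The image of I in C/omega, defined for every ideal I.  If contains_omega I
   holds then cls f lies in it iff f lies in I; in general it does not
   determine I. *)
Definition stable_mem (I : ideal C) : homClass stable :=
  fun A B p => exists f : @Mor C A B, ideal_in I f /\ p = cls f.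

Section StableIdeal.
Variable I : ideal C.

Fact stable_mem0 (A B : stable) : stable_mem I (0 : Mor A B).
Proof. by exists 0; split; [exact: ideal0 | rewrite cls0]. Qed.
Fact stable_memB (A B : stable) (f g : Mor A B) :
  stable_mem I f -> stable_mem I g -> stable_mem I (f - g).
Proof.
move=> [f' [If ->]] [g' [Ig ->]]; exists (f' - g').
by split; [exact: idealB | rewrite clsB].
Qed.
Fact stable_mem_compl (A B X : stable) (g : Mor B X) (f : Mor A B) :
  stable_mem I f -> stable_mem I (g \c f).
Proof.
move=> [f' [If ->]]; have [g' ->] := cls_surj g.
by exists (g' \c f'); split; [exact: ideal_compl | rewrite /= scompE].
Qed.
Fact stable_mem_compr (A B X : stable) (g : Mor B X) (f : Mor A B) :
  stable_mem I g -> stable_mem I (g \c f).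
Proof.
move=> [g' [Ig ->]]; have [f' ->] := cls_surj f.
by exists (g' \c f'); split; [exact: ideal_compr | rewrite /= scompE].
Qed.

Definition stable_ideal : ideal stable :=
  Ideal stable_mem0 stable_memB stable_mem_compl stable_mem_compr.
End StableIdeal.

Section Shift.
Variables (frobC : frobenius C) (S : cosyzygy C).
Local Notation "'Σ' A" := (csS S A) (at level 9, A at level 8).

Lemma pull_eq0_factor A B X (x : Mor A B) (y : Mor B X) (d : EE X A) Y
    (c : Mor Y X) : real d x y -> pull c d = 0 -> exists b, c = y \c b.
Proof.
move=> r e; have [T [i1 [i2 [p1 [p2 b]]]]] := @has_biprod C A Y.
have [|h [_ hy]] := @real_mor _ _ _ _ _ _ _ _ _ _ _ _ _ (idm A) c
  (real_zero b) r; first by rewrite e push0r.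
by exists (h \c i2); rewrite mcompA hy -mcompA; case: b => _ -> _ _ _;
  rewrite mcomp_idr.
Qed.

Lemma null_of_pull A B (c : Mor A (Σ B)) :
  pull c (cs_ext S B) = 0 -> via_omega c.
Proof.
move=> /(pull_eq0_factor (cs_real S B))[b ->].
have [_ _ /(_ (csI S B)) [_ inj_proj]] := frobC.
exists (csI S B), b, (cs_out S B); split=> //.
by split; [apply: inj_proj|]; exact: cs_inj.
Qed.

Lemma cls_pull_eq A B (c c' : Mor A (Σ B)) :
  pull c (cs_ext S B) = pull c' (cs_ext S B) -> cls c = cls c'.
Proof.
by move=> e; apply/cls_eq; apply: null_of_pull; rewrite pullBl e subrr.
Qed.

Lemma cls_shift_eq A B (f g : Mor A B) :
  cls f = cls g -> cls (csS_mor S f) = cls (csS_mor S g).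
Proof.
move=> /cls_eq[W [u [v [[_ iW] e]]]]; apply: cls_pull_eq.
rewrite -!cs_ext_mor -[f](subrK g) e pushDl push_comp.
by rewrite (iW _ (push u _)) push0r add0r.
Qed.

Definition sshift (A B : stable) (p : Mor A B) : @Mor stable (Σ A) (Σ B) :=
  cls (csS_mor S (repr p)).

Lemma sshiftE A B (f : Mor A B) : @sshift A B (cls f) = cls (csS_mor S f).
Proof. by apply: cls_shift_eq; rewrite /cls reprK. Qed.

Lemma sshift_id (A : stable) : sshift (idm A) = idm (Σ A : stable).
Proof.
rewrite sshiftE; apply: cls_pull_eq.
by rewrite -cs_ext_mor push_id pull_id.
Qed.

Lemma sshift_comp (A B X : stable) (g : Mor B X) (f : Mor A B) :
  sshift (g \c f) = sshift g \c sshift f.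
Proof.
have [f' ->] := cls_surj f; have [g' ->] := cls_surj g.
rewrite /= scompE !sshiftE scompE; apply: cls_pull_eq.
by rewrite -cs_ext_mor pull_comp -cs_ext_mor push_comp -push_pull -cs_ext_mor.
Qed.

Lemma sshiftD (A B : stable) (f g : Mor A B) :
  sshift (f + g) = sshift f + sshift g.
Proof.
have [f' ->] := cls_surj f; have [g' ->] := cls_surj g.
rewrite -clsD !sshiftE -clsD; apply: cls_pull_eq.
by rewrite -cs_ext_mor pullDl pushDl -!cs_ext_mor.
Qed.

(* The bifunctor E(X, A) = C/omega(X, Sigma A). *)
Definition stable_biext : biext stable.
Proof.
refine (@Biext stable (fun X A => @Mor stable X (Σ A))
  (fun X A A' a d => sshift a \c d) (fun X X' A c d => d \c c)
  _ _ _ _ _ _ _ _ _).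
- by move=> X A d; rewrite sshift_id mcomp_idl.
- by move=> X A d; rewrite mcomp_idr.
- by move=> X A B D g f d; rewrite sshift_comp mcompA.
- by move=> X Y Z A g f d; rewrite mcompA.
- by move=> X X' A A' a c d; rewrite mcompA.
- by move=> X A A' a d d'; rewrite mcompDr.
- by move=> X X' A c d d'; rewrite mcompDl.
- by move=> X A A' a a' d; rewrite sshiftD mcompDl.
- by move=> X X' A c c' d; rewrite mcompDr.
Defined.

Definition stableData : extData stable := ExtData stable_biext sshift.

(* In C/omega this gives E^k(f, g) = C/omega(f, Sigma^k g). *)
Lemma stable_Extk_mapE k (A B X Y : stable) (f : Mor A B) (g : Mor X Y)
    (d : Extk stableData k.+1 B X) :
  Extk_map stableData k.+1 f g d = shift_mor stableData k.+1 g \c (d \c f).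
Proof. by []. Qed.

End Shift.
End Stable.

(* Main.v *)
Require Import Defs.
From mathcomp Require Import all_boot.
From mathcomp Require Import all_algebra.

(** Pulling back the chosen triangle on [A] identifies [C/omega(X, Sigma A)] with [E(X, A)].
    Under this identification the map [E^k(f, g)] becomes [C/omega(f, Sigma^k g)], so [f] and [g]
    are orthogonal in [C] exactly when their classes are orthogonal in [C/omega].  An ideal
    containing [omega] is the full preimage of its image in [C/omega], and a stable precover
    of [M] becomes a precover in [C] once a deflation [P -> M] from a projective is added to it;
    dually for preenvelopes. *)

Set Implicit Arguments.
Unset Strict Implicit.
Unset Printing Implicit Defensive.

Import GRing.Theory.
Local Open Scope ring_scope.

Section ExtriangulatedTheory.
Variable C : extriCat.
Implicit Types A B X Y M : C.

(** Since [push a d = 0], the pair [a], [idm X] is a morphism from [d] to the split extension of [X]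
    by [Y]; its middle map, projected to [Y], extends [a] along [x]. *)
Lemma push_eq0_factor A B X (x : Mor A B) (y : Mor B X) (d : EE X A) Y
    (a : Mor A Y) : real d x y -> push a d = 0 -> exists b, a = b \c x.
Proof.
move=> r e; have [T [i1 [i2 [p1 [p2 b]]]]] := @has_biprod C Y X.
have [|h [hx _]] := @real_mor _ _ _ _ _ _ _ _ _ _ _ _ _ a (idm X)
  r (real_zero b); first by rewrite e pull0r.
exists (p1 \c h); rewrite -mcompA hx mcompA; case: b => -> _ _ _ _.
by rewrite mcomp_idl.
Qed.

Lemma pull_via_omega A X Y (c : Mor Y X) (d : EE X A) :
  via_omega c -> pull c d = 0.
Proof.
by move=> [W [u [v [[pW _] ->]]]]; rewrite pull_comp (pW _ (pull v d)) pull0r.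
Qed.

(** As [csI A] is injective, [cs_in S A] extends along [x]; (ET3) then yields [c] on the third
    terms. *)
Lemma cosyzygy_pull_surj (S : cosyzygy C) X A (d : EE X A) :
  exists c : Mor X (csS S A), d = pull c (cs_ext S A).
Proof.
have [B [x [y r]]] := real_ex d.
have [b e] := push_eq0_factor r (@cs_inj _ S A _ (push (cs_in S A) d)).
have [|c [_ ec]] := @ET3 _ _ _ _ _ _ _ _ _ _ _ _ _ (idm A) b r (cs_real S A).
  by rewrite mcomp_idr.
by exists c; rewrite -ec push_id.
Qed.

Lemma cls_eq0 A B (f : Mor A B) : cls f = 0 <-> via_omega f.
Proof. by rewrite -(cls0 A B) cls_eq subr0. Qed.

Lemma idealD (I : ideal C) A B (f g : Mor A B) :
  ideal_in I f -> ideal_in I g -> ideal_in I (f + g).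
Proof.
move=> If Ig; rewrite -[g]opprK; apply: idealB => //.
by rewrite -sub0r; apply: idealB => //; exact: ideal0.
Qed.

Section IdealContainingOmega.
Variables (I : ideal C) (omegaI : contains_omega I).

Lemma contains_omega_via A B (f : Mor A B) : via_omega f -> ideal_in I f.
Proof.
move=> [W [u [v [w ->]]]]; apply: ideal_compr.
by rewrite -[v]mcomp_idr; apply: ideal_compl; exact: omegaI.
Qed.

(** Two representatives of a class differ by a morphism through omega, which lies in [I]. *)
Lemma stable_mem_cls A B (f : Mor A B) : stable_mem I (cls f) <-> ideal_in I f.
Proof.
split=> [[g [Ig /cls_eq/contains_omega_via]]|If]; last by exists f.
by move=> /idealD/(_ Ig); rewrite subrK.
Qed.

End IdealContainingOmega.

Lemma precovering_stable (I : ideal C) :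
  precovering I -> precovering (stable_ideal I).
Proof.
move=> pI M; have [X [f [If fP]]] := pI M; exists X, (cls f).
split=> [|X' _ [g [Ig ->]]]; first by exists f.
by have [h <-] := fP _ _ Ig; exists (cls h); rewrite /= scompE.
Qed.

Lemma preenveloping_stable (J : ideal C) :
  preenveloping J -> preenveloping (stable_ideal J).
Proof.
move=> pJ M; have [X [f [Jf fP]]] := pJ M; exists X, (cls f).
split=> [|X' _ [g [Jg ->]]]; first by exists f.
by have [h <-] := fP _ _ Jg; exists (cls h); rewrite /= scompE.
Qed.

Lemma precovering_of_stable (I : ideal C) :
  frobenius C -> contains_omega I -> precovering (stable_ideal I) -> precovering I.
Proof.
move=> [eP _ PI] omegaI pI M; have [X [_ [[f [If ->]] fP]]] := pI M.
have [P [y [pP [A [d [x r]]]]]] := eP M.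
have [T [i1 [i2 [p1 [p2 [e1 e2 e3 e4 _]]]]]] := @has_biprod C X P.
exists T, (f \c p1 + y \c p2); split=> [|X' g Ig].
  apply: idealD; first exact: ideal_compr.
  apply: contains_omega_via => //; exists P, p2, y; split=> //.
  by split=> //; apply/PI.
have [|h'] := fP X' (cls g); first by exists g.
have [h ->] := cls_surj h'; rewrite /= scompE => /esym/cls_eq[W [u [v [w e]]]].
(* The error [g - f \c h] is [v \c u] with [W] projective, so [v] lifts along the deflation [y]; the
   lift gives the component into [P]. *)
have [v' ev] := pull_eq0_factor r (w.1 _ (pull v d)).
exists (i1 \c h + i2 \c v' \c u).
rewrite mcompDl !mcompDr -!mcompA !(mcompA p1) !(mcompA p2) e1 e2 e3 e4.
rewrite !mcomp_idl !mcomp0l !mcomp0r addr0 add0r (mcompA y) -ev -e.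
by rewrite addrC subrK.
Qed.

Lemma preenveloping_of_stable (J : ideal C) :
  frobenius C -> contains_omega J -> preenveloping (stable_ideal J) -> preenveloping J.
Proof.
move=> [_ eI PI] omegaJ pJ M; have [X [_ [[f [Jf ->]] fP]]] := pJ M.
have [Q [x [iQ [A [d [y r]]]]]] := eI M.
have [T [i1 [i2 [p1 [p2 [e1 e2 e3 e4 _]]]]]] := @has_biprod C X Q.
exists T, (i1 \c f + i2 \c x); split=> [|X' g Jg].
  apply: idealD; first exact: ideal_compl.
  apply: contains_omega_via => //; exists Q, x, i2; split=> //.
  by split=> //; apply/PI.
have [|h'] := fP X' (cls g); first by exists g.
have [h ->] := cls_surj h'; rewrite /= scompE => /esym/cls_eq[W [u [v [w e]]]].
(* Dually, [W] is injective, so [u] extends along the inflation [x]. *)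
have [u' eu] := push_eq0_factor r (w.2 _ (push u d)).
exists (h \c p1 + v \c u' \c p2).
rewrite mcompDl !mcompDr -!mcompA !(mcompA p1) !(mcompA p2) e1 e2 e3 e4.
rewrite !mcomp_idl !mcomp0l !mcomp0r addr0 add0r -eu -e.
by rewrite addrC subrK.
Qed.

Section Perpendicular.
Variables (frobC : frobenius C) (S : cosyzygy C).
Local Notation D := (extriData S).
Local Notation sD := (stableData frobC S).

Lemma shift_mor_cls m A B (f : Mor A B) :
  @shift_mor _ sD m A B (cls f) = cls (shift_mor D m f).
Proof. by elim: m => //= m ->; rewrite (sshiftE frobC). Qed.

Lemma shift_mor0 m (A B : stable C) : @shift_mor _ sD m A B 0 = 0.
Proof.
elim: m => //= m ->.
by apply: (addrI (sshift S 0)); rewrite -(sshiftD frobC) !addr0.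
Qed.

(** Both maps send the element represented by [c] to the one represented by
    [shift_mor D k g \c (c \c f)], and on either side an element vanishes exactly when its
    representative factors through omega. *)
Lemma Extk_map_stable k A B X Y (f : Mor A B) (g : Mor X Y) : (0 < k)%N ->
  (forall d, Extk_map D k f g d = 0) <->
  (forall d, @Extk_map _ sD k A B X Y (cls f) (cls g) d = 0).
Proof.
case: k => // k _.
(* Level [k.+1] involves only [k] shifts; the last one comes from the chosen triangles, where
   [cs_ext_mor] trades a push for a pull along the shifted map. *)
have pullE (c : Mor B (csS S (shift_obj D k X))) :
    Extk_map D k.+1 f g (pull c (cs_ext S _)) =
    pull (shift_mor D k.+1 g \c (c \c f)) (cs_ext S _).
  by rewrite /Extk_map /= !push_pull cs_ext_mor !pull_comp.
have clsE (c : Mor B (csS S (shift_obj D k X))) :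
    @Extk_map _ sD k.+1 A B X Y (cls f) (cls g) (cls c) =
    cls (shift_mor D k.+1 g \c (c \c f)).
  by rewrite -!scompE -(shift_mor_cls k.+1).
split=> H d.
  have [c ->] := @cls_surj _ _ (csS S (shift_obj D k X)) d.
  by rewrite clsE; apply/cls_eq0/(null_of_pull frobC); rewrite -pullE.
have [c ->] := @cosyzygy_pull_surj S B (shift_obj D k X) d.
by rewrite pullE; apply/pull_via_omega/cls_eq0; rewrite -clsE.
Qed.

Lemma lperp_stable k (J : ideal C) A B (f : Mor A B) : (0 < k)%N ->
  lperp D k J f <-> @lperp _ sD k (stable_ideal J) A B (cls f).
Proof.
move=> k0; split=> H X Y s Js.
  by case: Js => s' [Js' ->]; apply/Extk_map_stable => //; exact: H.
by apply/Extk_map_stable => //; apply: H; exists s.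
Qed.

Lemma rperp_stable k (I : ideal C) A B (g : Mor A B) : (0 < k)%N ->
  rperp D k I g <-> @rperp _ sD k (stable_ideal I) A B (cls g).
Proof.
move=> k0; split=> H X Y s Is.
  by case: Is => s' [Is' ->]; apply/Extk_map_stable => //; exact: H.
by apply/Extk_map_stable => //; apply: H; exists s.
Qed.

(** The identity of [W] is zero in [C/omega], hence orthogonal to everything there, and
    orthogonality transfers back to [C]. *)
Lemma rperp_omega k (I : ideal C) (W : C) :
  (0 < k)%N -> omega W -> rperp D k I (idm W).
Proof.
move=> k0 w A B s _; apply/Extk_map_stable => // d.
have -> : cls (idm W) = 0.
  by apply/cls_eq0; exists W, (idm W), (idm W); rewrite mcomp_idl.
by rewrite /Extk_map shift_mor0 push0l.
Qed.

End Perpendicular.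
End ExtriangulatedTheory.

(** The image of [J] in [C/omega] determines [J] only up to morphisms through omega, hence the
    clause [contains_omega J] on the right; on the left it follows because [J] is an intersection of
    right perpendiculars. *)
Theorem theorem4p7 (C : extriCat) (frobC : frobenius C) (S : cosyzygy C)
    (n : nat) (n_gt0 : (0 < n)%N) (I J : ideal C)
    (omegaI : contains_omega I) :
  ideal_cotorsion_pair (extriData S) n I J <->
  contains_omega J /\
  ideal_cotorsion_pair (stableData frobC S) n (stable_ideal I) (stable_ideal J).
Proof.
split=> [[lI rJ pI pJ]|[omegaJ [lI rJ pI pJ]]].
  have omegaJ : contains_omega J.
    by move=> W w; apply/rJ => k /andP[k0 _]; exact: (rperp_omega frobC).
  split=> //; split; last 2 first.
  - exact: precovering_stable.
  - exact: preenveloping_stable.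
  - move=> A B p; have [f ->] := cls_surj p.
    apply: iff_trans (stable_mem_cls omegaI f) _; apply: iff_trans (lI _ _ f) _.
    by split=> H k kn; have /andP[k0 _] := kn; apply/lperp_stable => //; exact: H.
  - move=> A B p; have [f ->] := cls_surj p.
    apply: iff_trans (stable_mem_cls omegaJ f) _; apply: iff_trans (rJ _ _ f) _.
    by split=> H k kn; have /andP[k0 _] := kn; apply/rperp_stable => //; exact: H.
split; last 2 first.
- exact: precovering_of_stable.
- exact: preenveloping_of_stable.
- move=> A B f; apply: iff_trans (iff_sym (stable_mem_cls omegaI f)) _.
  apply: iff_trans (lI A B (cls f)) _.
  by split=> H k kn; have /andP[k0 _] := kn; apply/(lperp_stable frobC) => //; exact: H.
- move=> A B f; apply: iff_trans (iff_sym (stable_mem_cls omegaJ f)) _.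
  apply: iff_trans (rJ A B (cls f)) _.
  by split=> H k kn; have /andP[k0 _] := kn; apply/(rperp_stable frobC) => //; exact: H.
Qed.
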